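(* Let $\mathcal{A}$ be a finite alphabet, let $T=\mathcal{A}^{<\mathbb{N}}$ be the full tree over $\mathcal{A}$, let $Z\subseteq T$, and let $W=\bigcup_{p\in Z}[T_p]$. If $$\sum_{p\in Z}\frac{1}{|\mathcal{A}|^{\lfloor \mathrm{len}(p)/2\rfloor}}<1,$$ then Player 2 has a winning strategy in the game $(T,W)$. Moreover, if $|Z|=\infty$, the weaker condition $$\sum_{p\in Z}\frac{1}{|\mathcal{A}|^{\lfloor \mathrm{len}(p)/2\rfloor}}\le 1$$ already suffices for Player 2 to have a winning strategy in $(T,W)$.
   Context: $\mathcal{A}^{<\mathbb{N}}$ is the set of all finite sequences over $\mathcal{A}$ (including the empty sequence $\langle\rangle$); its elements are called positions, and $\mathrm{len}(p)$ is the length of $p$. A play is an infinite sequence in $\mathcal{A}^{\mathbb{N}}$; $[T]=\mathcal{A}^{\mathbb{N}}$ is the set of plays, and for $p\in T$, $[T_p]$ is the set of plays having $p$ as a prefix. In the game $(T,W)$ with $W\subseteq[T]$, two players alternately choose actions in $\mathcal{A}$, with Player 1 moving at positions of even length (in particular first) and Player 2 at positions of odd length, each knowing all previous moves; Player 1 wins if the resulting play lies in $W$, and otherwise Player 2 wins. A strategy of Player 1 (Player 2) is a function assigning an action to every position of even (odd) length; it is winning if every play consistent with it is won by that player. *)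

(* Defs.v *)
From HB Require Import structures.
From mathcomp Require Import all_boot all_order all_algebra.
From mathcomp Require Import all_classical all_reals.
From mathcomp Require Import ereal esum.

Set Implicit Arguments.
Unset Strict Implicit.
Unset Printing Implicit Defensive.

Local Open Scope classical_set_scope.

(* The full tree over [A] is the type [seq A], so a set of positions is a
   [set (seq A)]. *)
Definition play (A : Type) : Type := nat -> A.

(* [mkseq x n] is the initial segment [:: x 0; ...; x n.-1] of [x]. *)
Definition plays_through (A : Type) (p : seq A) : set (play A) :=
  [set x : play A | mkseq x (size p) = p].

(* Taking only the positions of odd length as the domain also covers the empty
   alphabet, for which there is no function [seq A -> A]. *)
Definition strategy2 (A : Type) : Type := {p : seq A | odd (size p)} -> A.

Definition consistent2 (A : Type) (s : strategy2 A) (x : play A) : Prop :=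
  forall p : {p : seq A | odd (size p)},
    plays_through (val p) x -> x (size (val p)) = s p.

(* [W] is the set of plays won by Player 1. *)
Definition winning2 (A : Type) (W : set (play A)) (s : strategy2 A) : Prop :=
  forall x : play A, consistent2 s x -> ~ W x.

(* Main.v *)
(** Call a position [q] safe when the total weight of the elements of [Z]
    extending [q] is less than the weight |A|^{-floor(len(q)/2)} of [q] itself,
    or at most that weight while infinitely many elements of [Z] extend [q].
    A safe position is not in [Z].  A move of Player 1 does not change the
    weight of the position, so it preserves safety.  The weights of the
    positions reached by the possible moves of Player 2 add up to the weight of
    the current position, so by averaging one of them is safe.  Player 2 wins
    by never leaving the safe positions. *)

Require Import Defs.
From HB Require Import structures.
From mathcomp Require Import all_boot all_order all_algebra.
From mathcomp Require Import all_classical all_reals.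
From mathcomp Require Import ereal esum.

Import Order.TTheory GRing.Theory Num.Theory.

Local Open Scope classical_set_scope.
Local Open Scope ring_scope.
Local Open Scope ereal_scope.

Lemma le_esum_subset {R : realType} {T : choiceType} (B C : set T)
    (f : T -> \bar R) : (forall t, 0 <= f t) -> B `<=` C ->
  \esum_(t in B) f t <= \esum_(t in C) f t.
Proof.
move=> f0 /setIidr BC.
by rewrite [leRHS](esumID B)// BC leeDl// esum_ge0.
Qed.

(** The term at [t] is a positive gain on top of the sum over [B]; since that sum is finite, the
    gain is strict. *)
Lemma lt_esum_subset {R : realType} {T : choiceType} (B C : set T)
    (f : T -> \bar R) (t : T) :
  (forall u, 0 <= f u) -> B `<=` C -> C t -> ~ B t -> 0 < f t ->
  \esum_(u in B) f u \is a fin_num ->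
  \esum_(u in B) f u < \esum_(u in C) f u.
Proof.
move=> f0 /setIidr BC Ct nBt ft Bfin.
rewrite [ltRHS](esumID B)// BC lteDl// (lt_le_trans ft)//.
rewrite -[leLHS](@esum_set1 _ _ t f)//; apply: le_esum_subset => //.
by move=> _ ->.
Qed.

(** After exchanging the sums, each [t] is counted at most once, by disjointness. *)
Lemma sum_esum_trivIset {R : realType} {T : choiceType} {I : finType}
    (J : I -> set T) (C : set T) (f : T -> \bar R) :
  trivIset setT J -> (forall i, J i `<=` C) -> (forall t, 0 <= f t) ->
  \sum_i \esum_(t in J i) f t <= \esum_(t in C) f t.
Proof.
move=> tJ JC f0.
under eq_bigr => i _ do rewrite -(setIidr (JC i)) esum_mkcondr.
rewrite -esum_sum => [|t i _ _]; last by case: ifP.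
apply: le_esum => t _.
have [[i Jit]|nJ] := pselect (exists i, J i t); last first.
  by rewrite big1// => i _; rewrite memNset// => Jit; apply: nJ; exists i.
rewrite (bigD1 i)//= mem_set// big1 ?adde0// => j /eqP ji.
by rewrite memNset// => Jjt; apply: ji; apply: tJ => //; exists t.
Qed.

Lemma lte_sum_witness {R : realType} {I : finType} (f g : I -> \bar R) :
  \sum_i f i < \sum_i g i -> exists i, f i < g i.
Proof.
move=> fg; apply: contrapT => /forallNP ngf; move: fg; rewrite ltNge => /negP.
by apply; apply: lee_sum => i _; rewrite leNgt; apply/negP/ngf.
Qed.

Definition weight (R : realType) (A : finType) (q : seq A) : \bar R :=
  (1 / #|A|%:R ^+ (size q)./2)%:E.

Definition extensions {A : eqType} (Z : set (seq A)) (q : seq A) : set (seq A) :=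
  Z `&` [set p | prefix q p].

Definition mass (R : realType) {A : finType} (Z : set (seq A)) (q : seq A) :=
  \esum_(p in extensions Z q) weight R A p.

Definition safe (R : realType) {A : finType} (Z : set (seq A)) (q : seq A) :=
  mass R Z q < weight R A q \/
  infinite_set (extensions Z q) /\ mass R Z q <= weight R A q.

Lemma weight_ge0 (R : realType) (A : finType) (q : seq A) : 0 <= weight R A q.
Proof. by rewrite lee_fin divr_ge0// exprn_ge0. Qed.

Lemma weight_gt0 (R : realType) (A : finType) (q : seq A) :
  (0 < #|A|)%N -> 0 < weight R A q.
Proof. by move=> A0; rewrite lte_fin divr_gt0// exprn_gt0// ltr0n. Qed.

Lemma weight_rcons_even (R : realType) (A : finType) (q : seq A) (a : A) :
  ~~ odd (size q) -> weight R A (rcons q a) = weight R A q.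
Proof.
by move=> qe; rewrite /weight size_rcons -uphalfE uphalf_half (negbTE qe).
Qed.

Lemma sum_weight_rcons_odd (R : realType) (A : finType) (q : seq A) :
  (0 < #|A|)%N -> odd (size q) ->
  \sum_(a : A) weight R A (rcons q a) = weight R A q.
Proof.
move=> A0 qo; rewrite sumEFin; congr _%:E.
under eq_bigr do rewrite size_rcons -uphalfE uphalf_half qo exprS.
by rewrite sumr_const !div1r invfM -[LHS]mulr_natl mulVKf// pnatr_eq0 -lt0n.
Qed.

Lemma mass_ge0 (R : realType) (A : finType) (Z : set (seq A)) (q : seq A) :
  0 <= mass R Z q.
Proof. by apply: esum_ge0 => p _; exact: weight_ge0. Qed.

Lemma safe_le {R : realType} {A : finType} {Z : set (seq A)} {q : seq A} :
  safe R Z q -> mass R Z q <= weight R A q.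
Proof. by case=> [/ltW|[]]. Qed.

Lemma extensions_rcons (A : eqType) (Z : set (seq A)) (q : seq A) (a : A) :
  extensions Z (rcons q a) `<=` extensions Z q.
Proof.
move=> p [Zp /= qap]; split=> //=.
exact: prefix_trans (prefix_rcons _ _) qap.
Qed.

Lemma trivIset_extensions (A : eqType) (Z : set (seq A)) (q : seq A) :
  trivIset setT (fun a => extensions Z (rcons q a)).
Proof.
move=> a b _ _ [p [[_ /= pa] [_ /= pb]]].
move: pa pb; rewrite !prefixE !size_rcons => /eqP pa /eqP.
by rewrite pa => /rcons_inj[].
Qed.

Lemma extensions_split (A : eqType) (Z : set (seq A)) (q : seq A) :
  extensions Z q `<=` [set q] `|` \bigcup_a extensions Z (rcons q a).
Proof.
move=> p [Zp /= /prefixP[[|a r] pE]]; first by left; rewrite /= pE cats0.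
right; exists a => //; split=> //=; rewrite pE -cat_rcons; exact: prefix_prefix.
Qed.

Lemma infinite_extensions_rcons (A : finType) (Z : set (seq A)) (q : seq A) :
  infinite_set (extensions Z q) ->
  exists a, infinite_set (extensions Z (rcons q a)).
Proof.
move=> qoo; apply: contrapT => /forallNP fin; apply: qoo.
apply: sub_finite_set (extensions_split _ _ _) _; rewrite finite_setU; split=> //.
apply: bigcup_finite => [|a _]; [exact: finite_finset|exact: contrapT (fin a)].
Qed.

(** Equality can fail: [q] itself may lie in [Z], and it extends no [rcons q a]. *)
Lemma sum_mass_rcons (R : realType) (A : finType) (Z : set (seq A)) (q : seq A) :
  \sum_(a : A) mass R Z (rcons q a) <= mass R Z q.
Proof.
apply: sum_esum_trivIset => [|a|p].
- exact: trivIset_extensions.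
- exact: extensions_rcons.
- exact: weight_ge0.
Qed.

(** If [q] were in [Z], it alone would bring the mass up to its weight; in the infinite case a
    second extension pushes the mass strictly above it. *)
Lemma safe_notin (R : realType) (A : finType) (Z : set (seq A)) (q : seq A) :
  (0 < #|A|)%N -> safe R Z q -> ~ Z q.
Proof.
move=> A0 sq Zq.
have qq : [set q] `<=` extensions Z q by move=> _ ->; split=> //=; exact: prefix_refl.
have massq1 : \esum_(p in [set q]) weight R A p = weight R A q.
  by rewrite esum_set1// weight_ge0.
have w0 (p : seq A) := weight_ge0 R A p.
have qle : weight R A q <= mass R Z q by rewrite -massq1; exact: le_esum_subset.
case: sq => [|[qoo]]; first by rewrite ltNge qle.
have /infinite_setN0[p [qp /= pq]] : infinite_set (extensions Z q `\` [set q]).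
  by apply: infinite_setD.
apply/negP; rewrite -ltNge -massq1; apply: (@lt_esum_subset _ _ _ _ _ p) => //.
  exact: weight_gt0.
by rewrite massq1.
Qed.

Lemma safe_rcons_even (R : realType) (A : finType) (Z : set (seq A))
    (q : seq A) (a : A) :
  ~~ odd (size q) -> safe R Z q -> safe R Z (rcons q a).
Proof.
move=> qe sq; have A0 : (0 < #|A|)%N by apply/card_gt0P; exists a.
have w0 (p : seq A) := weight_ge0 R A p.
have leqa : mass R Z (rcons q a) <= mass R Z q.
  by apply: le_esum_subset => //; exact: extensions_rcons.
rewrite /safe weight_rcons_even//.
case: (sq) => [qlt|[qoo qle]]; first by left; exact: le_lt_trans qlt.
have [fin|inf] := pselect (finite_set (extensions Z (rcons q a))); last first.
  by right; split=> //; exact: le_trans qle.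
left; apply: lt_le_trans qle.
(* When only finitely many extensions survive the move, some extension [p] of [q] is lost, and its
   positive weight makes the inequality strict. *)
have /infinite_setN0[p [qp qap]] := infinite_setD qoo fin.
apply: (@lt_esum_subset _ _ _ _ _ p) => //; first exact: extensions_rcons.
  exact: weight_gt0.
rewrite ge0_fin_numE; last exact: mass_ge0.
by apply: le_lt_trans leqa _; apply: le_lt_trans (safe_le sq) _; rewrite ltry.
Qed.

(** In the infinite case, averaging alone could yield a letter with equality but finitely many
    extensions. So a letter [a] with infinitely many extensions is tried first; if its mass exceeds
    its weight, the other letters have a strict deficit in total, and one of them is safe. *)
Lemma safe_rcons_odd (R : realType) (A : finType) (Z : set (seq A))
    (q : seq A) :
  odd (size q) -> safe R Z q -> exists a, safe R Z (rcons q a).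
Proof.
move=> qo sq.
have A0 : (0 < #|A|)%N by case: q qo {sq} => // a q _; apply/card_gt0P; exists a.
have sumw := sum_weight_rcons_odd R A q A0 qo.
have summ := sum_mass_rcons R A Z q.
case: (sq) => [qlt|[qoo qle]].
  have [|a alt] := @lte_sum_witness _ _ (fun a => mass R Z (rcons q a))
                     (fun a => weight R A (rcons q a)).
    by rewrite sumw; exact: le_lt_trans qlt.
  by exists a; left.
have [a aoo] := infinite_extensions_rcons A Z q qoo.
have [ale|alt] := leP (mass R Z (rcons q a)) (weight R A (rcons q a)).
  by exists a; right.
(* Putting 0 at [a] restricts the averaging to the other letters; the witness cannot be [a], as
   [0 < 0] fails. *)
have [|b blt] := @lte_sum_witness _ _
    (fun b => if b == a then 0 else mass R Z (rcons q b))
    (fun b => if b == a then 0 else weight R A (rcons q b)); last first.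
  by case: eqP blt => [|_ blt]; [rewrite ltxx|exists b; left].
have drop (f : A -> \bar R) :
    \sum_b (if b == a then 0 else f b) = \sum_(b | b != a) f b.
  by rewrite [RHS]big_mkcond/=; apply: eq_bigr => b _; case: eqP.
rewrite !drop ltNge; apply/negP => ge.
have := le_trans summ qle; rewrite -sumw (bigD1 a)//= [leRHS](bigD1 a)//=.
apply/negP; rewrite -ltNge; apply: lte_leD => //.
by rewrite sumEFin.
Qed.

Lemma safe_winning (R : realType) (A : finType) (Z : set (seq A)) :
  safe R Z [::] ->
  exists s : strategy2 A, winning2 (\bigcup_(p in Z) plays_through p) s.
Proof.
move=> safe0.
have /choice[s sP] (p : {p : seq A | odd (size p)}) :
    exists a, safe R Z (val p) -> safe R Z (rcons (val p) a).
  have [sp|nsp] := pselect (safe R Z (val p)).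
    by have [a ?] := safe_rcons_odd R A Z (val p) (valP p) sp; exists a.
  (* At an unsafe position any letter will do; the first letter of the position exists because its
     length is odd. *)
  by case: p nsp => -[//|a p] qo nsp; exists a.
exists s => x xs [p Zp xp].
have safex n : safe R Z (mkseq x n).
  elim: n => // n IH; rewrite mkseqS.
  have [on|en] := boolP (odd n); last first.
    by apply: safe_rcons_even; rewrite ?size_mkseq.
  have on' : odd (size (mkseq x n)) by rewrite size_mkseq.
  pose q : {p : seq A | odd (size p)} := Sub (mkseq x n) on'.
  by have := xs q; rewrite /plays_through/= size_mkseq => ->//; exact: (sP q).
(* A play won by Player 1 would have an element [p] of [Z] as an initial segment, yet [p] would be
   safe. *)
have := safex (size p); rewrite xp => /safe_notin; apply=> //.
by apply/card_gt0P; exists (x 0%N).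
Qed.

Theorem lemma2p7 (R : realType) (A : finType) (Z : set (seq A))
    (W : set (play A)) (W_def : W = \bigcup_(p in Z) plays_through p) :
  (\esum_(p in Z) (1 / #|A|%:R ^+ (size p)./2 : R)%:E < 1 ->
     exists s : strategy2 A, winning2 W s) /\
  (infinite_set Z ->
     \esum_(p in Z) (1 / #|A|%:R ^+ (size p)./2 : R)%:E <= 1 ->
     exists s : strategy2 A, winning2 W s).
Proof.
(* At the root the mass is the whole sum and the weight is 1, so the two hypotheses are the two ways
   for the root to be safe. *)
have ext0 : extensions Z [::] = Z.
  by apply/seteqP; split=> [p []//|p Zp]; split=> //=; exact: prefix0s.
have weight0 : weight R A [::] = 1 by rewrite /weight expr0 divr1.
by rewrite W_def; split=> [lt1|Zoo le1]; apply: (@safe_winning R);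
  [left|right]; rewrite /mass ext0 weight0.
Qed.
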